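(* Let $G_{39}$ be the graph defined in the context. Then $a(G_{39})=19$ and $r_a(G_{39})=\frac{19}{39}<\frac12$. Thus $G_{39}$, which is a simple planar graph on $39$ vertices, is a counterexample to the Albertson-Berman conjecture (the assertion that $a(G)\ge \frac n2$ for every simple planar graph $G$ on $n$ vertices), and the Albertson-Berman conjecture does not hold.
   Context: For a (finite simple) graph $G$, $a(G)$ denotes the number of vertices in the largest induced forest in $G$ (an induced subgraph that is a forest), and $r_a(G)=\frac{a(G)}{n}$ where $n$ is the number of vertices of $G$. The graph $G_{14}$ has the $14$ vertices $c_1,c_2,u_1,\dots,u_6,v_1,v_2,v_3,v_4,w_1,w_2$ and exactly the following $36$ edges: - the hexagon $u_1u_2,\ u_2u_3,\ u_3u_4,\ u_4u_5,\ u_5u_6,\ u_6u_1$; - $c_1c_2$; $c_1u_1,\ c_1u_2,\ c_1u_5,\ c_1u_6$; $c_2u_2,\ c_2u_3,\ c_2u_4,\ c_2u_5$; - $v_1v_2,\ v_2v_3,\ v_3v_4,\ v_4v_1$; $v_1u_1,\ v_1u_2,\ v_1u_3$; $v_2u_3,\ v_2u_4$; $v_3u_4,\ v_3u_5,\ v_3u_6$; $v_4u_1,\ v_4u_6$; - $w_1w_2$; $w_1v_2,\ w_1v_3,\ w_1v_4$; $w_2v_1,\ w_2v_2,\ w_2v_4$. The graph $G_{39}$ is obtained by taking a triangle and attaching to each of its three edges a separate copy of $G_{14}$ by the edge $w_1w_2$: the edge $w_1w_2$ of the copy (together with its two endpoints) is identified with the given edge of the triangle, and otherwise the copies are disjoint.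 (The direction of each identification does not matter up to isomorphism, since $G_{14}$ has an automorphism interchanging $w_1$ and $w_2$.) It has $3\cdot 14-3=39$ vertices. *)

(* Defs.v *)
From HB Require Import structures.
From mathcomp Require Import all_boot all_order all_algebra.
From mathcomp Require Import all_classical all_reals all_analysis.

Set Implicit Arguments.
Unset Strict Implicit.
Unset Printing Implicit Defensive.

Import Order.TTheory GRing.Theory Num.Theory.
Import numFieldNormedType.Exports.

Record sgraph := SGraph {
  vertex :> finType;
  adj : rel vertex;
  adj_sym : symmetric adj;
  adj_irr : irreflexive adj }.

Section Forests.
Variable G : sgraph.

Section Induced.
Variable S : {set G}.

Definition induced_adj : rel {x : G | x \in S} :=
  fun x y => adj (val x) (val y).

Lemma induced_adj_sym : symmetric induced_adj.
Proof. by move=> x y; apply: adj_sym. Qed.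

Lemma induced_adj_irr : irreflexive induced_adj.
Proof. by move=> x; apply: adj_irr. Qed.

Definition induced : sgraph := SGraph induced_adj_sym induced_adj_irr.

End Induced.

(* The bound on the size is needed because [:: x; y] is a cycle in the sense
   of [path.cycle] as soon as x and y are adjacent. *)
Definition forest : Prop :=
  forall c : seq G, 3 <= size c -> ~ ucycle (@adj G) c.

End Forests.

Definition forest_number (G : sgraph) : nat :=
  \max_(S : {set G} | `[< forest (induced S) >]) #|S|.

Definition forest_ratio (G : sgraph) : rat :=
  ((forest_number G)%:R / #|G|%:R)%R.

Section Planarity.
Local Open Scope ring_scope.
Variable R : realType.

Definition simple_arc (g : R -> R * R) : Prop :=
  {within `[0, 1], continuous g}%classic /\ {in `[0, 1] &, injective g}.

(* [pos x] is the point representing the vertex x, and [arc x y] the curve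
   representing the edge xy, run from x to y; [arc x y] is irrelevant when
   x and y are not adjacent. *)
Record plane_drawing (G : sgraph)
    (pos : G -> R * R) (arc : G -> G -> R -> R * R) : Prop := PlaneDrawing {
  drawing_pos_inj : injective pos;
  drawing_arc : forall x y, adj x y -> simple_arc (arc x y);
  drawing_arc0 : forall x y, adj x y -> arc x y 0 = pos x;
  drawing_arc1 : forall x y, adj x y -> arc x y 1 = pos y;
  drawing_arc_rev : forall x y, adj x y ->
    {in `[0, 1], forall t, arc y x t = arc x y (1 - t)};
  drawing_arc_vertex : forall x y z, adj x y ->
    {in `]0, 1[, forall t, arc x y t <> pos z};
  drawing_arc_disjoint : forall x y x' y', adj x y -> adj x' y' ->
    [set x; y]%SET <> [set x'; y']%SET ->
    {in `]0, 1[ &, forall s t, arc x y s <> arc x' y' t} }.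

Definition planar (G : sgraph) : Prop :=
  exists pos arc, @plane_drawing G pos arc.

Definition albertson_berman : Prop :=
  forall G : sgraph, planar G ->
    #|G|%:R / 2 <= (forest_number G)%:R :> rat.

End Planarity.

Inductive V14 : predArgType :=
  | c1 | c2 | u1 | u2 | u3 | u4 | u5 | u6 | v1 | v2 | v3 | v4 | w1 | w2.

Definition V14_enum : seq V14 :=
  [:: c1; c2; u1; u2; u3; u4; u5; u6; v1; v2; v3; v4; w1; w2].

Definition V14_code (x : V14) : nat :=
  match x with
  | c1 => 0 | c2 => 1
  | u1 => 2 | u2 => 3 | u3 => 4 | u4 => 5 | u5 => 6 | u6 => 7
  | v1 => 8 | v2 => 9 | v3 => 10 | v4 => 11
  | w1 => 12 | w2 => 13
  end.

Lemma V14_codeK : cancel V14_code (nth c1 V14_enum).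
Proof. by case. Qed.

HB.instance Definition _ := Countable.copy V14 (can_type V14_codeK).

Lemma V14_enumP : Finite.axiom V14_enum.
Proof. by case. Qed.

HB.instance Definition _ := fintype.isFinite.Build V14 V14_enumP.

Definition G14_edges : seq (V14 * V14) :=
  [:: (u1, u2); (u2, u3); (u3, u4); (u4, u5); (u5, u6); (u6, u1);
      (c1, c2); (c1, u1); (c1, u2); (c1, u5); (c1, u6);
      (c2, u2); (c2, u3); (c2, u4); (c2, u5);
      (v1, v2); (v2, v3); (v3, v4); (v4, v1);
      (v1, u1); (v1, u2); (v1, u3);
      (v2, u3); (v2, u4);
      (v3, u4); (v3, u5); (v3, u6);
      (v4, u1); (v4, u6);
      (w1, w2); (w1, v2); (w1, v3); (w1, v4);
      (w2, v1); (w2, v2); (w2, v4)].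

Definition G14_adj : rel V14 :=
  fun x y => ((x, y) \in G14_edges) || ((y, x) \in G14_edges).

Lemma G14_adj_sym : symmetric G14_adj.
Proof. by move=> x y; rewrite /G14_adj orbC. Qed.

Lemma G14_adj_irr : irreflexive G14_adj.
Proof. by case. Qed.

Definition G14 : sgraph := SGraph G14_adj_sym G14_adj_irr.

(* The three vertices of the triangle, and three copies of the twelve
   vertices of G14 other than w1 and w2. *)
Definition V39 : finType :=
  ('I_3 + 'I_3 * {x : V14 | x \notin [:: w1; w2]})%type.

(* The i-th copy of G14 is glued to the edge {i, i+1 mod 3} of the triangle:
   w1 becomes the vertex i and w2 the vertex i+1. *)
Definition copy14 (i : 'I_3) (x : V14) : V39 :=
  if insub x is Some x' then inr (i, x')
  else inl (if x == w1 then i else ordS i).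

Definition triangle_adj : rel V39 := fun p q =>
  match p, q with inl i, inl j => i != j | _, _ => false end.

Definition G39_adj : rel V39 := fun p q =>
  triangle_adj p q ||
  [exists i, exists x, exists y,
     [&& G14_adj x y, copy14 i x == p & copy14 i y == q]].

Lemma copy14_inj i : injective (copy14 i).
Proof.
have ordSN : ordS i != i by case: i => -[|[|[|]]].
move=> x y; rewrite /copy14.
case: insubP => [a _ <-|xN]; case: insubP => [b _ <-|yN] //.
  by case=> ->.
move: xN yN; rewrite !negbK !inE => /orP[] /eqP-> /orP[] /eqP-> //=.
  by case=> /esym/eqP; rewrite (negPf ordSN).
by case=> /eqP; rewrite (negPf ordSN).
Qed.

Lemma G39_adj_sym : symmetric G39_adj.
Proof.
suff sub p q : G39_adj p q -> G39_adj q p by move=> p q; apply/idP/idP; apply: sub.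
case/orP=> [pq|/existsP[i /existsP[x /existsP[y /and3P[xy xp yq]]]]].
  by apply/orP; left; case: p q pq => [i|?] [j|?] //=; rewrite eq_sym.
apply/orP; right; apply/existsP; exists i; apply/existsP; exists y.
by apply/existsP; exists x; rewrite G14_adj_sym xy xp yq.
Qed.

Lemma G39_adj_irr : irreflexive G39_adj.
Proof.
move=> p; apply/negP=> /orP[|/existsP[i /existsP[x /existsP[y]]]].
  by case: p => //= i; rewrite eqxx.
case/and3P=> xy /eqP xp /eqP yp; move: xy.
by rewrite (copy14_inj (etrans xp (esym yp))) G14_adj_irr.
Qed.

Definition G39 : sgraph := SGraph G39_adj_sym G39_adj_irr.

(* Main.v *)
Require Import Defs.
From mathcomp Require Import all_boot all_order all_algebra.
From mathcomp Require Import all_classical all_reals all_analysis.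
From mathcomp Require Import ring lra zify.

(** The three copies of [G14] share only the corners [w1], [w2] of the triangle,
so the forest number reduces to a count per copy.

Upper bound. An induced forest contains at most 6 of the twelve inner vertices
of a copy, and at most 5 when it contains both [w1] and [w2]
([count_inner14]). This is a finite fact: fifty cycles of [G14] are listed such
that every larger set contains one of them, and a branching search confirms it
([hitting_boundP]). Let the forest contain [k] corners; then [k <= 2], as the
triangle is a cycle. If [k <= 1] it has at most [3 * 6 + k <= 19] vertices. If
[k = 2], one copy loses an inner vertex, which leaves [6 + 6 + 5 + 2 = 19].

Lower bound. In [G14] the path u3 u4 u5 c1 u1 v4 is induced, and [w1] and [w2]
are each adjacent to its last vertex v4 only. The three copies of this path
together with a single corner therefore induce two disjoint paths, with
[3 * 6 + 1 = 19] vertices ([two_paths_forest], [card_two_paths]).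

Planarity. [G14] has a straight-line drawing in the first quadrant with [w1] on
the horizontal axis, [w2] on the vertical axis at the same distance from the
origin, and everything else strictly inside. The linear map
[(x, y) |-> (- y, x - y)] has order 3, carries [w1] to [w2], and moves the
quadrant to two further sectors that together with it cover the plane. Drawing
copy [i] as the [i]-th image gives a drawing of [G39]: objects in different
copies lie in disjoint sectors ([turn_sector]), and within one copy it is enough
to check the drawing of [G14], which is an integer computation with orientations
of triangles ([grid14_vertex_off_edge], [grid14_edges_apart]). *)

Set Implicit Arguments.
Unset Strict Implicit.
Unset Printing Implicit Defensive.

Import Order.TTheory GRing.Theory Num.Theory.
Import numFieldNormedType.Exports.
Local Open Scope ring_scope.

(** * The vertices and edges of G39 as copies of those of G14 *)

(** Every corner lies in two copies, as [w1] of one and as [w2] of the preceding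
one. Choosing [w1] makes the address unique: [home] is inverse to [copy14] away
from [w2]. *)
Definition home (p : G39) : 'I_3 * V14 :=
  match p with inl i => (i, w1) | inr (i, x) => (i, val x) end.

Lemma copy14_inner i (x : {x : V14 | x \notin [:: w1; w2]}) :
  copy14 i (val x) = inr (i, x).
Proof. by rewrite /copy14 valK. Qed.

Lemma copy14_w1 i : copy14 i w1 = inl i.
Proof. by rewrite /copy14 insubN ?eqxx // negbK. Qed.

Lemma copy14_w2 i : copy14 i w2 = inl (ordS i).
Proof. by rewrite /copy14 insubN // negbK. Qed.

Lemma home_neq_w2 p : (home p).2 != w2.
Proof. by case: p => [i|[i [x xin]]] //=; apply: contra xin => /eqP->. Qed.

Lemma homeK p : copy14 (home p).1 (home p).2 = p.
Proof. by case: p => [i|[i x]] /=; rewrite ?copy14_w1 ?copy14_inner. Qed.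

Lemma copy14K i x : x != w2 -> home (copy14 i x) = (i, x).
Proof.
move=> xw2; have [->|xw1] := eqVneq x w1; first by rewrite copy14_w1.
have xin : x \notin [:: w1; w2] by rewrite !inE negb_or xw1.
by have /= -> := copy14_inner i (exist _ x xin).
Qed.

Lemma copy14_adj i x y : G14_adj x y -> adj (copy14 i x : G39) (copy14 i y).
Proof.
move=> xy; apply/orP; right; apply/existsP; exists i; apply/existsP; exists x.
by apply/existsP; exists y; rewrite xy !eqxx.
Qed.

(** The triangle needs no separate treatment: its edges are the copies of the edge
w1w2. *)
Lemma G39_adjP (p q : G39) : adj p q ->
  exists i x y, [/\ G14_adj x y, p = copy14 i x & q = copy14 i y].
Proof.
case/orP; last first.
  case/existsP=> i /existsP[x /existsP[y /and3P[xy /eqP<- /eqP<-]]].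
  by exists i, x, y.
case: p q => [i|?] [j|?] //= neq_ij.
have : j = ordS i \/ i = ordS j.
  case: i j neq_ij => [[|[|[|//]]] ?] [[|[|[|//]]] ?] //= _;
    by [left; apply: val_inj | right; apply: val_inj].
case=> ->; [exists i, w1, w2 | exists j, w2, w1];
  by rewrite copy14_w1 copy14_w2.
Qed.

Lemma sum_G39 (F : G39 -> nat) :
  (\sum_p F p = \sum_(i < 3) \sum_(x | x != w2) F (copy14 i x))%N.
Proof.
rewrite pair_big_dep /=; symmetry.
rewrite (reindex_onto home (fun ix => copy14 ix.1 ix.2)) /=; last first.
  by case=> i x; apply: copy14K.
by apply: eq_big => [p|p _]; rewrite ?home_neq_w2 homeK ?eqxx.
Qed.

Definition inner14 : seq V14 := [:: c1; c2; u1; u2; u3; u4; u5; u6; v1; v2; v3; v4].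

Lemma sum_V14_inner (F : V14 -> nat) :
  (\sum_(x | x != w2) F x = F w1 + \sum_(x <- inner14) F x)%N.
Proof.
have -> : index_enum V14 = V14_enum by rewrite [LHS]unlock unlock.
rewrite /inner14 !big_cons !big_nil /=. lia.
Qed.

Lemma card_G39_set (S : {set G39}) :
  (#|S| = \sum_(i < 3)
     ((inl i \in S) + count (fun x => copy14 i x \in S) inner14))%N.
Proof.
rewrite -sum1_card big_mkcond sum_G39; apply: eq_bigr => i _.
rewrite sum_V14_inner copy14_w1 -sum1_count [in RHS]big_mkcond.
by case: (_ \in S).
Qed.

Lemma card_G39 : #|G39| = 39%N.
Proof.
rewrite -cardsT card_G39_set.
rewrite (eq_bigr (fun=> 13%N)) ?sum_nat_const ?card_ord // => i _.
by rewrite inE (eq_count (a2 := predT)) // => x; rewrite /= inE.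
Qed.

(** * Upper bound *)

(** A branching search that verifies that every set of vertices among [vs] that
contains none of the cycles [cs] has at most [m] elements. If the first vertex
is left out, the cycles through it are harmless and are dropped; if it is put
in, it is erased from the cycles, and a cycle that has become empty is contained
in the set, which ends the branch. *)
Fixpoint hitting_bound (T : eqType) (cs : seq (seq T)) (vs : seq T) (m : nat) :=
  (size vs <= m)%N ||
  if vs is v :: vs' then
    hitting_bound [seq c <- cs | v \notin c] vs' m &&
    let cs' := [seq [seq x <- c | x != v] | c <- cs] in
    ([::] \in cs') || (if m is m'.+1 then hitting_bound cs' vs' m' else false)
  else true.

Lemma all_filter_neq (T : eqType) (b : pred T) (v : T) (c : seq T) :
  b v -> all b [seq x <- c | x != v] = all b c.
Proof.
move=> bv; rewrite all_filter; apply: eq_all => x /=.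
by case: eqVneq => //= ->; rewrite bv.
Qed.

Lemma hitting_boundP (T : eqType) (b : pred T) cs vs m :
  hitting_bound cs vs m -> (forall c, c \in cs -> ~~ all b c) ->
  (count b vs <= m)%N.
Proof.
elim: vs cs m => [//|v vs IH] cs m /= /orP[szm _|/andP[hout hin] hit].
  by apply: leq_trans szm; apply: count_size b (v :: vs).
have [bv|_] := boolP (b v); last first.
  by apply: IH hout _ => c; rewrite mem_filter => /andP[_ /hit].
have hit' c : c \in [seq [seq x <- c | x != v] | c <- cs] -> ~~ all b c.
  by case/mapP=> d /hit hd ->; rewrite all_filter_neq.
case/orP: hin => [/hit' //|]; case: m {hout} => // m hin.
by rewrite add1n ltnS; apply: IH hin hit'.
Qed.

(** Selected, among all induced cycles, so that the two searches in
[count_inner14] succeed. *)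
Definition G14_cycles : seq (seq V14) :=
 [::
  [:: c1; c2; u2];
  [:: u4; u5; v3];
  [:: c1; u1; u6];
  [:: u2; u3; v1];
  [:: c2; u3; u4];
  [:: u1; v1; v4];
  [:: u5; u6; v3];
  [:: u4; v2; v3];
  [:: c1; c2; u5];
  [:: u1; u2; v1];
  [:: u3; v1; v2];
  [:: u1; u6; v4];
  [:: c1; u1; u2];
  [:: c1; u5; u6];
  [:: c2; u2; u3];
  [:: c2; u4; u5];
  [:: u6; v3; v4];
  [:: u3; u4; v2];
  [:: v2; w1; w2];
  [:: v4; w1; w2];
  [:: v1; v2; v3; v4];
  [:: c1; c2; u3; v1; u1];
  [:: c2; u2; v1; v2; u4];
  [:: c1; c2; u4; v3; u6];
  [:: c2; u3; v2; v3; u5];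
  [:: c1; u2; v1; v4; u6];
  [:: c1; u1; v4; v3; u5];
  [:: u1; u2; u3; u4; u5; u6];
  [:: c1; u1; v1; u3; u4; u5];
  [:: c2; u3; v1; u1; u6; u5];
  [:: u1; u6; u5; u4; u3; v1];
  [:: c1; u2; v1; v2; u4; u5];
  [:: c2; u2; u1; u6; v3; u4];
  [:: c1; u2; u3; u4; v3; u6];
  [:: u1; u2; u3; u4; v3; u6];
  [:: c1; u2; u3; v2; v3; u5];
  [:: c2; u2; v1; v4; u6; u5];
  [:: u4; u5; u6; v4; v1; v2];
  [:: c2; u2; u1; v4; v3; u5];
  [:: u1; u2; u3; v2; v3; v4];
  [:: u3; u4; v3; w1; w2; v1];
  [:: u1; u6; v3; w1; w2; v1];
  [:: c1; c2; u4; v2; v1; v4; u6];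
  [:: c1; c2; u3; v2; v3; v4; u1];
  [:: c2; u2; v1; w2; w1; v3; u4];
  [:: c1; u1; v1; w2; w1; v3; u5];
  [:: c2; u3; v1; w2; w1; v3; u5];
  [:: c1; u2; v1; w2; w1; v3; u6];
  [:: c1; c2; u4; v3; w1; w2; v1; u1];
  [:: c1; c2; u3; v1; w2; w1; v3; u6]
 ].

Lemma G14_cyclesP c :
  c \in G14_cycles -> (2 < size c)%N && ucycleb G14_adj c.
Proof. by move: c; apply/allP; vm_compute. Qed.

Lemma count_inner14 (b : pred V14) :
  (forall c, c \in G14_cycles -> ~~ all b c) ->
  (count b inner14 + (b w1 && b w2) <= 6)%N.
Proof.
move=> hit; have [/andP[bw1 bw2]|_] := boolP (b w1 && b w2).
  rewrite addn1 ltnS.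
  (* Here w1 and w2 are in the set, so they are erased from the cycles first. *)
  apply: (hitting_boundP
    (cs := [seq [seq x <- [seq x <- c | x != w1] | x != w2] | c <- G14_cycles])).
    by vm_compute.
  by move=> ? /mapP[c /hit hc ->]; rewrite !all_filter_neq.
by rewrite addn0; apply: hitting_boundP hit; vm_compute.
Qed.

Lemma forest_no_ucycle (G : sgraph) (S : {set G}) (c : seq G) :
  forest (Defs.induced S) -> (2 < size c)%N -> ucycle (@adj G) c ->
  ~~ all (mem S) c.
Proof.
move=> forestS szc /andP[cyc uc]; apply/negP => /allP cS.
pose d : seq (Defs.induced S) := pmap insub c.
have dE : map val d = c.
  rewrite pmap_filter; last exact: insubK.
  by apply/all_filterP/allP => x /cS xS; rewrite insubT.
apply: (forestS d); first by rewrite -(size_map val) dE.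
apply/andP; split; last by rewrite -(map_inj_uniq val_inj) dE.
by move: cyc; rewrite -dE cycle_map.
Qed.

(** The bounds for the three copies and for the triangle are linear inequalities
in the three inner counts and the three corner indicators; they add up to 19. *)
Lemma forest_G39_bound (S : {set G39}) : forest (Defs.induced S) -> (#|S| <= 19)%N.
Proof.
move=> forestS.
have copy_bound i : (count (fun x => copy14 i x \in S) inner14 +
    ((inl i \in S) && (inl (ordS i) \in S)) <= 6)%N.
  rewrite -copy14_w1 -copy14_w2; apply: (@count_inner14 (fun x => copy14 i x \in S)).
  move=> c /G14_cyclesP/andP[szc /andP[cyc uc]].
  have := @forest_no_ucycle G39 S (map (copy14 i) c) forestS.
  rewrite size_map all_map; apply=> //.
  rewrite /ucycle map_inj_uniq ?uc ?andbT; last exact: copy14_inj.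
  by rewrite cycle_map; apply: sub_cycle cyc => x y; apply: copy14_adj.
have : ~~ [&& inl ord0 \in S, inl (ordS ord0) \in S & inl (ordS (ordS ord0)) \in S].
  have := @forest_no_ucycle G39 S
    [:: inl ord0; inl (ordS ord0); inl (ordS (ordS ord0)) : G39] forestS.
  by rewrite /= andbT; apply.
have S3 : ordS (ordS (ordS ord0)) = ord0 :> 'I_3 by apply: val_inj.
move: (copy_bound ord0) (copy_bound (ordS ord0)) (copy_bound (ordS (ordS ord0))).
rewrite card_G39_set !big_ord_recl big_ord0 S3.
have -> : lift ord0 ord0 = ordS ord0 :> 'I_3 by apply: val_inj.
have -> : lift ord0 (lift ord0 ord0) = ordS (ordS ord0) :> 'I_3 by apply: val_inj.
move: (count _ _) (count _ _) (count _ _) => n0 n1 n2.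
by do 3!case: (inl _ \in S) => //=; lia.
Qed.

(** * Lower bound *)

(** On a cycle, a vertex of least rank has two distinct neighbours of no smaller
rank. Hence a set is acyclic as soon as its vertices can be removed one after
the other, each having at most one neighbour left when it is removed. *)
Lemma forest_of_rank (G : sgraph) (S : {set G}) (r : G -> nat) :
  (forall x y z, x \in S -> y \in S -> z \in S -> adj x y -> adj x z ->
     (r x <= r y)%N -> (r x <= r z)%N -> y = z) ->
  forest (Defs.induced S).
Proof.
move=> oneS c szc ucyc.
have [x xc xmin] : exists2 x, x \in c & forall y, y \in c -> (r (val x) <= r (val y))%N.
  case: c szc {ucyc} => // x0 c _.
  case: (@arg_minnP _ x0 (mem (x0 :: c)) (fun x => r (val x))) => [|x xc xmin].
    exact: mem_head.
  by exists x.
case: (rot_to xc) => k d cE; move: ucyc szc.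
rewrite -(rot_ucycle k) -(size_rot k) cE => /andP[cyc uniqd].
case: d cE cyc uniqd => [|y d] // cE; case/lastP: d cE => [//|d z] cE.
rewrite /cycle rcons_path /= => /andP[/andP[xy _] zx] /and3P[_ yd _] _.
have memc w : w \in [:: x, y & rcons d z] -> w \in c by rewrite -cE mem_rot.
have xz : adj (val x) (val z) by rewrite adj_sym; move: zx; rewrite last_rcons.
have yz : val y = val z.
  apply: oneS (valP x) (valP y) (valP z) xy xz _ _; apply/xmin/memc.
    by rewrite !inE eqxx orbT.
  by rewrite !inE mem_rcons inE eqxx !orbT.
by move: yd; rewrite (val_inj yz) mem_rcons inE eqxx.
Qed.

(** Along this path each vertex is adjacent to the next one only, among the later
ones, and both [w1] and [w2] are adjacent to its end v4 only. The order of the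
list is the order of removal. *)
Definition path14 : seq V14 := [:: u3; u4; u5; c1; u1; v4].

Definition two_paths : {set G39} :=
  [set p : G39 | match p with
                 | inl i => i == ord0
                 | inr (_, x) => val x \in path14
                 end].

Lemma path14_unique x y z :
  x \in path14 ->
  y \in path14 ++ [:: w1; w2] -> z \in path14 ++ [:: w1; w2] ->
  G14_adj x y -> G14_adj x z ->
  (index x path14 <= index y path14)%N ->
  (index x path14 <= index z path14)%N ->
  [|| y == z, (y == w1) && (z == w2) | (y == w2) && (z == w1)].
Proof.
pose later x y := G14_adj x y && (index x path14 <= index y path14)%N.
have chk : all (fun x => all (fun y => all (fun z => later x y && later x z ==>
    [|| y == z, (y == w1) && (z == w2) | (y == w2) && (z == w1)])
    (path14 ++ [:: w1; w2])) (path14 ++ [:: w1; w2])) path14.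
  by vm_compute.
move=> xp yp zp xy xz ixy ixz.
move/allP: chk => /(_ x xp)/allP/(_ y yp)/allP/(_ z zp).
by rewrite /later xy xz ixy ixz.
Qed.

Lemma copy14_two_paths i x :
  (copy14 i x \in two_paths) =
  [|| x \in path14, (x == w1) && (i == ord0) | (x == w2) && (ordS i == ord0)].
Proof.
rewrite inE; have [->|xw2] := eqVneq x w2; first by rewrite copy14_w2.
have [->|xw1] := eqVneq x w1; first by rewrite copy14_w1 /= orbF.
have xin : x \notin [:: w1; w2] by rewrite !inE negb_or xw1.
by have /= -> := copy14_inner i (exist _ x xin); rewrite orbF.
Qed.

Lemma inner_adjP i x (q : G39) : adj (inr (i, x) : G39) q ->
  exists2 y, G14_adj (val x) y & q = copy14 i y.
Proof.
case/G39_adjP=> j [x' [y [x'y xE ->]]].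
have x'w2 : x' != w2.
  by apply/eqP => x'w2; move: xE; rewrite x'w2 copy14_w2.
have [jE x'E] : (j, x') = (i, val x) by rewrite -(copy14K j x'w2) -xE.
by exists y; [move: x'y; rewrite x'E | rewrite jE].
Qed.

(** The rank is the position on the path, and [index] gives the corners the largest
rank, 6. The only vertices that could keep two neighbours are the copies of v4,
next to both corners of their copy; but no copy has both corners in the set. *)
Lemma two_paths_forest : forest (Defs.induced two_paths).
Proof.
pose r p := index (home p).2 path14.
have r_copy i y : r (copy14 i y) = index y path14.
  rewrite /r; have [->|yw2] := eqVneq y w2; last by rewrite copy14K.
  by rewrite copy14_w2.
apply: (@forest_of_rank _ _ r) => p q q'.
case: p => [i|[i x]].
  rewrite inE => /eqP -> qS _ pq _ rq _; exfalso.
  move: qS pq rq; case: q => [j|[j y]]; rewrite inE.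
    by move/eqP=> ->; rewrite adj_irr.
  by rewrite /r /= -index_mem => yp _; rewrite leqNgt yp.
rewrite inE => xp qS q'S /inner_adjP[y xy qE] /inner_adjP[y' xy' q'E].
move: qS q'S; rewrite {}qE {}q'E !copy14_two_paths !r_copy => yS y'S ry ry'.
have inpath (j : 'I_3) u :
    [|| u \in path14, (u == w1) && (j == ord0) | (u == w2) && (ordS j == ord0)] ->
    u \in path14 ++ [:: w1; w2].
  by rewrite mem_cat !inE; case/or3P=> [->//|/andP[-> _]|/andP[-> _]];
    rewrite ?orbT.
have not_both : ~~ (((w1 == w1) && (i == ord0)) && ((w2 == w2) && (ordS i == ord0))).
  by apply/negP => /andP[/eqP ->].
case/or3P: (path14_unique xp (inpath i _ yS) (inpath i _ y'S) xy xy' ry ry').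
- by move/eqP->.
- case/andP=> /eqP yE /eqP y'E; move: yS y'S not_both; rewrite yE y'E.
  by rewrite !orbF /= => -> ->.
- case/andP=> /eqP yE /eqP y'E; move: yS y'S not_both; rewrite yE y'E.
  by rewrite !orbF /= => -> ->.
Qed.

Lemma card_two_paths : #|two_paths| = 19%N.
Proof.
rewrite card_G39_set (eq_bigr (fun i => (i == ord0) + 6)%N) => [|i _].
  by rewrite !big_ord_recl big_ord0.
rewrite inE; congr addn.
rewrite (eq_in_count (a2 := mem path14)) // => x xin.
rewrite copy14_two_paths.
have [xw1|_] := eqVneq x w1; first by rewrite xw1 in xin.
by have [xw2|_] := eqVneq x w2; [rewrite xw2 in xin | rewrite orbF].
Qed.

Lemma forest_number_G39 : forest_number G39 = 19%N.
Proof.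
apply/eqP; rewrite eqn_leq; apply/andP; split.
  by apply/bigmax_leqP => S /asboolP; apply: forest_G39_bound.
rewrite -card_two_paths; apply: leq_bigmax_cond; apply/asboolP; exact: two_paths_forest.
Qed.

(** * Segments and orientations *)

Section Segments.
Variable R : realFieldType.
Implicit Types (a b c d p q : R * R) (t : R).

Definition segment a b t : R * R :=
  (a.1 + t * (b.1 - a.1), a.2 + t * (b.2 - a.2)).

(** Twice the signed area of the triangle [a b c]; it vanishes on the line [a b]. *)
Definition orient a b c : R :=
  (b.1 - a.1) * (c.2 - a.2) - (b.2 - a.2) * (c.1 - a.1).

Lemma segment_rev a b t : segment a b t = segment b a (1 - t).
Proof. by rewrite /segment; congr pair; ring. Qed.

Lemma segment0 a b : segment a b 0 = a.
Proof. by case: a => a1 a2; rewrite /segment !mul0r !addr0. Qed.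

Lemma segment1 a b : segment a b 1 = b.
Proof. by case: b => b1 b2; rewrite /segment /=; congr pair; ring. Qed.

Lemma segment_inj a b : a <> b -> injective (segment a b).
Proof.
case: a b => [a1 a2] [b1 b2] ab s t [/addrI e1 /addrI e2].
apply/eqP/negP => st; apply: ab.
have ne : s - t != 0 by rewrite subr_eq0; apply/negP.
by congr pair; apply/eqP; rewrite -subr_eq0 -(mulrI_eq0 _ (mulfI ne)); apply/eqP;
  [lra|lra].
Qed.

Lemma orient_segment a b c d t :
  orient a b (segment c d t) = (1 - t) * orient a b c + t * orient a b d.
Proof. by rewrite /orient /segment /=; ring. Qed.

Lemma orient_on_segment a b t : orient a b (segment a b t) = 0.
Proof. by rewrite /orient /segment /=; ring. Qed.

(** [c] and [d] lie in the same closed half-plane of the line [a b] and are not both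
on that line: when the product is nonnegative, a vanishing sum means that both
orientations vanish. The weak form also covers segments with a common end. *)
Definition one_side a b c d :=
  (0 <= orient a b c * orient a b d) && (orient a b c + orient a b d != 0).

(** The orientation is affine in its last argument, so it has a strict sign on the
open segment [c d], while it vanishes on [a b]. *)
Lemma one_side_disjoint a b c d s t :
  one_side a b c d -> 0 < t < 1 -> segment a b s <> segment c d t.
Proof.
case/andP=> side nz /andP[t0 t1] /(congr1 (orient a b)).
rewrite orient_on_segment orient_segment.
move: (orient a b c) (orient a b d) side nz => x y side nz /esym e.
have t1' : 0 < 1 - t by lra.
have [x0|x0] := ltP 0 x.
- have y0 : 0 <= y by rewrite -(pmulr_rge0 _ x0).
  by nra.
- have [x_eq|x_ne] := eqVneq x 0.
    by move: e nz; rewrite x_eq mulr0 !add0r => /eqP; rewrite mulf_eq0 gt_eqF //= => ->.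
  have xn : x < 0 by rewrite lt_neqAle x_ne.
  have y0 : y <= 0 by rewrite -(nmulr_rge0 _ xn).
  by nra.
Qed.

End Segments.

(** * A linear symmetry of order three *)

Section Rotation.
Variable R : realFieldType.
Implicit Types (p q : R * R) (i j : 'I_3).

(** The [i]-th power of [(x, y) |-> (- y, x - y)], which permutes (1, 0), (0, 1) and
(-1, -1) cyclically. *)
Definition turn i p : R * R :=
  match val i with
  | 0%N => p
  | 1%N => (- p.2, p.1 - p.2)
  | _ => (p.2 - p.1, - p.1)
  end.

Lemma turn_segment i p q t :
  segment (turn i p) (turn i q) t = turn i (segment p q t).
Proof.
by case: i => [[|[|[|//]]] ?]; rewrite /turn /segment /=; congr pair; ring.
Qed.

Lemma turn_inj i : injective (turn i).
Proof.
by case: i => [[|[|[|//]]] ?] [x1 x2] [y1 y2]; rewrite /turn //= => -[e1 e2];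
  congr pair; lra.
Qed.

(** The quadrant without the vertical half-axis, so that its three images are
disjoint. They cover the plane minus the origin. *)
Definition in_sector p := (0 < p.1) && (0 <= p.2).

Lemma turn_sector i j p q :
  in_sector p -> in_sector q -> turn i p = turn j q -> i = j.
Proof.
case: p q => [p1 p2] [q1 q2] /andP[/= ? ?] /andP[/= ? ?].
case: i j => [[|[|[|//]]] ?] [[|[|[|//]]] ?]; rewrite /turn /= => -[e1 e2];
  solve [exact: val_inj | exfalso; lra].
Qed.

Lemma turn_ordS i (k : R) : turn (ordS i) (k, 0) = turn i (0, k).
Proof. by case: i => [[|[|[|//]]] ?]; rewrite /turn /=; congr pair; ring. Qed.

End Rotation.

(** * A grid drawing of G14 *)

(** A straight-line drawing with outer face w1 w2 v2. A vertex lies on the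
line through an edge only if it is an end of that edge. *)
Definition grid14 (x : V14) : nat * nat :=
  match x with
  | c1 => (17, 12) | c2 => (18, 15)
  | u1 => (12, 14) | u2 => (12, 15) | u3 => (16, 17)
  | u4 => (20, 16) | u5 => (19, 12) | u6 => (17, 11)
  | v1 => (9, 17) | v2 => (23, 22) | v3 => (21, 10) | v4 => (14, 11)
  | w1 => (22, 0) | w2 => (0, 22)
  end.

Definition orient14 (x y z : V14) : int :=
  let a := grid14 x in let b := grid14 y in let c := grid14 z in
  (b.1%:Z - a.1%:Z) * (c.2%:Z - a.2%:Z) - (b.2%:Z - a.2%:Z) * (c.1%:Z - a.1%:Z).

Definition one_side14 (e f : V14 * V14) :=
  let s := orient14 e.1 e.2 f.1 in let s' := orient14 e.1 e.2 f.2 in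
  (0 <= s * s') && (s + s' != 0).

Lemma grid14_vertex_off_edge e z : e \in G14_edges ->
  z != e.1 -> z != e.2 -> orient14 e.1 e.2 z != 0.
Proof.
have chk : all (fun e => all (fun z =>
    [|| z == e.1, z == e.2 | orient14 e.1 e.2 z != 0]) V14_enum) G14_edges.
  by vm_compute.
move=> /(allP chk)/allP/(_ z) + /negPf ze1 /negPf ze2.
by rewrite ze1 ze2; apply; rewrite -has_pred1 has_count V14_enumP.
Qed.

Lemma grid14_edges_apart e f : e \in G14_edges -> f \in G14_edges -> e != f ->
  one_side14 e f || one_side14 f e.
Proof.
have chk : all (fun e => all (fun f =>
    [|| e == f, one_side14 e f | one_side14 f e]) G14_edges) G14_edges.
  by vm_compute.
move=> /(allP chk)/allP/(_ f) + fE /negPf ef.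
by rewrite ef; apply.
Qed.

(** * The drawing of G39 *)

(** Segments supply the topological part of a drawing: continuity, injectivity and
reversal. *)
Lemma straight_drawing_planar (R : realType) (G : sgraph) (pos : G -> R * R) :
  injective pos ->
  (forall x y z, adj x y ->
     {in `]0, 1[, forall t, segment (pos x) (pos y) t <> pos z}) ->
  (forall x y x' y', adj x y -> adj x' y' -> [set x; y]%SET <> [set x'; y']%SET ->
     {in `]0, 1[ &, forall s t,
       segment (pos x) (pos y) s <> segment (pos x') (pos y') t}) ->
  planar R G.
Proof.
move=> pos_inj vertex_off edges_apart.
exists pos, (fun x y => segment (pos x) (pos y)); split=> //.
- move=> x y xy; split; last first.
    apply: in2W; apply: segment_inj => /pos_inj exy.
    by move: xy; rewrite exy adj_irr.
  apply: continuous_subspaceT => t.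
  have affine_cont (a b : R) : continuous (fun t : R => a + t * b : R).
    by move=> u; apply: cvgD; [exact: cvg_cst | apply: cvgMl; exact: cvg_id].
  exact: cvg_pair (affine_cont _ _ _) (affine_cont _ _ _).
- by move=> x y _; apply: segment0.
- by move=> x y _; apply: segment1.
- by move=> x y _ t _; apply: segment_rev.
Qed.

Section Drawing.
Variable R : realType.

Definition point14 (x : V14) : R * R := ((grid14 x).1%:R, (grid14 x).2%:R).

Lemma point14_inj : injective point14.
Proof.
suff grid_inj : injective grid14.
  move=> x y [/eqP e1 /eqP e2]; apply: grid_inj.
  move: e1 e2; rewrite !eqr_nat; case: (grid14 x) (grid14 y) => ? ? [? ?] /=.
  by move=> /eqP-> /eqP->.
by case; case.
Qed.

Lemma orient_point14 x y z :
  orient (point14 x) (point14 y) (point14 z) = (orient14 x y z)%:~R.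
Proof. by rewrite /orient /orient14 /= !rmorphB !rmorphM !rmorphB. Qed.

Lemma one_side_point14 e f : one_side14 e f ->
  one_side (point14 e.1) (point14 e.2) (point14 f.1) (point14 f.2).
Proof.
by rewrite /one_side !orient_point14 -rmorphM -rmorphD ler0z intr_eq0.
Qed.

Lemma point14_in_sector x : x != w2 -> in_sector (point14 x).
Proof. by rewrite /in_sector ler0n ltr0n andbT; case: x. Qed.

(** Only [w2] is on the vertical axis, so no segment runs along that axis. *)
Lemma segment14_in_sector x y t : x != y -> 0 < t < 1 ->
  in_sector (segment (point14 x) (point14 y) t).
Proof.
move=> xy /andP[t0 t1]; have t1' : 0 < 1 - t by rewrite subr_gt0.
have convex (u v : R) : u + t * (v - u) = (1 - t) * u + t * v by ring.
rewrite /in_sector /segment /= !convex; apply/andP; split; last first.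
  by rewrite addr_ge0 // mulr_ge0 ?ler0n // ltW.
have [xw2|/point14_in_sector/andP[x_gt0 _]] := eqVneq x w2; last first.
  by rewrite ltr_wpDr ?mulr_gt0 // mulr_ge0 ?ler0n // ltW.
have /point14_in_sector/andP[y_gt0 _] : y != w2 by rewrite eq_sym -xw2.
by rewrite ltr_wpDl ?mulr_gt0 // mulr_ge0 ?ler0n // ltW.
Qed.

(** By symmetry the edge may be taken in the orientation in which it is listed,
which is the one that the computation covers. *)
Lemma vertex_off_segment14 x y z t : G14_adj x y -> 0 < t < 1 ->
  segment (point14 x) (point14 y) t <> point14 z.
Proof.
wlog xy : x y t / (x, y) \in G14_edges.
  move=> H /orP[xy|yx] t01; first by apply: H => //; rewrite /G14_adj xy.
  rewrite segment_rev; apply: H => //; first by rewrite /G14_adj yx.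
  lra.
move=> adj_xy /andP[t0 t1] sz.
have pxy : point14 x <> point14 y.
  by move=> /point14_inj exy; move: adj_xy; rewrite exy G14_adj_irr.
have zx : z != x.
  apply/eqP => zx; move: sz; rewrite zx -[RHS](segment0 _ (point14 y)).
  by move/(segment_inj pxy) => t_0; rewrite t_0 ltxx in t0.
have zy : z != y.
  apply/eqP => zy; move: sz; rewrite zy -[RHS](segment1 (point14 x)).
  by move/(segment_inj pxy) => t_1; rewrite t_1 ltxx in t1.
have := grid14_vertex_off_edge xy zx zy; rewrite -(intr_eq0 R) -orient_point14.
by rewrite /= -sz orient_on_segment eqxx.
Qed.

Lemma segment14_apart x y x' y' s t : G14_adj x y -> G14_adj x' y' ->
  [set x; y]%SET <> [set x'; y']%SET -> 0 < s < 1 -> 0 < t < 1 ->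
  segment (point14 x) (point14 y) s <> segment (point14 x') (point14 y') t.
Proof.
wlog xy : x y s / (x, y) \in G14_edges.
  move=> H /orP[xy|yx] adj' ne s01; first by apply: H; rewrite // /G14_adj xy.
  rewrite segment_rev; apply: H; rewrite // ?/G14_adj ?yx //; last by lra.
  by rewrite finset.setUC.
wlog x'y' : x' y' t / (x', y') \in G14_edges.
  move=> H adjxy /orP[xy'|yx'] ne s01 t01; first by apply: H; rewrite // /G14_adj xy'.
  rewrite [in RHS]segment_rev; apply: H; rewrite // ?/G14_adj ?yx' //; last by lra.
  by rewrite [in RHS]finset.setUC.
move=> _ _ ne s01 t01.
have ef : (x, y) != (x', y') by apply/eqP => -[ex ey]; apply: ne; rewrite ex ey.
case/orP: (grid14_edges_apart xy x'y' ef) => /one_side_point14 side.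
  exact: one_side_disjoint side t01.
by move/esym; apply: one_side_disjoint side s01.
Qed.

Definition pos39 (p : G39) : R * R := turn (home p).1 (point14 (home p).2).

(** A corner is placed consistently by its two copies because the symmetry carries
the point of [w1] to that of [w2]. *)
Lemma pos39_copy i x : pos39 (copy14 i x) = turn i (point14 x).
Proof.
rewrite /pos39; have [->|xw2] := eqVneq x w2; last by rewrite copy14K.
by rewrite copy14_w2 /= turn_ordS.
Qed.

Lemma pos39_inj : injective pos39.
Proof.
move=> p q; rewrite -(homeK p) -(homeK q) !pos39_copy.
case: (home p) (home q) (home_neq_w2 p) (home_neq_w2 q) => [i x] [j y] /= xw yw e.
have ij := turn_sector (point14_in_sector xw) (point14_in_sector yw) e.
by move: e; rewrite ij => /turn_inj/point14_inj ->.
Qed.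

Lemma G14_adj_neq x y : G14_adj x y -> x != y.
Proof. by apply: contraTneq => ->; rewrite G14_adj_irr. Qed.

(** Two edges, or an edge and a vertex, that meet lie in the same sector, so they
belong to the same copy, where the drawing of [G14] forbids it. *)
Lemma planar_G39 : planar R G39.
Proof.
apply: (straight_drawing_planar pos39_inj).
  move=> _ _ z /G39_adjP[i [x [y [xy -> ->]]]] t; rewrite in_itv => t01.
  rewrite -(homeK z) !pos39_copy turn_segment => e.
  have ij := turn_sector (segment14_in_sector (G14_adj_neq xy) t01)
    (point14_in_sector (home_neq_w2 z)) e.
  by move: e; rewrite ij => /turn_inj; apply: vertex_off_segment14.
move=> _ _ _ _ /G39_adjP[i [x [y [xy -> ->]]]] /G39_adjP[j [x' [y' [xy' -> ->]]]].
move=> ne s t; rewrite !in_itv => s01 t01; rewrite !pos39_copy !turn_segment => e.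
have ij := turn_sector (segment14_in_sector (G14_adj_neq xy) s01)
    (segment14_in_sector (G14_adj_neq xy') t01) e.
move: e ne; rewrite ij => /turn_inj e ne.
apply: (segment14_apart xy xy' _ s01 t01 e) => exy; apply: ne.
by rewrite -!imset_set1 -!imsetU exy.
Qed.

End Drawing.

Theorem theorem1 (R : realType) :
  forest_number G39 = 19%N /\
  forest_ratio G39 = 19 / 39 /\
  (19 / 39 < 1 / 2 :> rat) /\
  #|G39| = 39%N /\
  planar R G39 /\
  ~ (#|G39|%:R / 2 <= (forest_number G39)%:R :> rat) /\
  ~ albertson_berman R.
Proof.
have not_half : ~ (#|G39|%:R / 2 <= (forest_number G39)%:R :> rat).
  by rewrite card_G39 forest_number_G39.
split; first exact: forest_number_G39.
split; first by rewrite /forest_ratio forest_number_G39 card_G39.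
split; first lra.
split; first exact: card_G39.
split; first exact: planar_G39.
split; first by [].
by move=> AB; apply/not_half/AB/planar_G39.
Qed.
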